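(* Let $n\ge 6$. Among all cycle barbells $CB(k,a,b)$ (with integers $a,b\ge3$, $k\ge2$) having exactly $n$ vertices, the non-backtracking Kemeny's constant $\mathscr{K}_{nb}$ is maximized at $CB(2,\lceil n/2\rceil,\lfloor n/2\rfloor)$. Moreover, for $n$ even, \[ \mathscr{K}_{nb}(CB(2,n/2,n/2))=\frac{11n^2+14n+2}{4(n+1)}, \] and for $n$ odd, \[ \mathscr{K}_{nb}(CB(2,(n+1)/2,(n-1)/2))=\frac{11n^2+14n+1}{4(n+1)}. \]
   Context: The cycle barbell $CB(k,a,b)$ is the graph obtained from a cycle $C_a$, a path $P_k$ on $k$ vertices and a cycle $C_b$ by identifying one endpoint of the path with a vertex of $C_a$ and the other endpoint with a vertex of $C_b$. It has $a+b+k-2$ vertices and $a+b+k-1$ edges. Kemeny's constant of an irreducible finite Markov chain with transition matrix $P$ whose eigenvalues (with multiplicity) are $1=\rho_1,\rho_2,\dots,\rho_N$ (with $1$ simple) is $\mathscr{K}(P)=\sum_{i=2}^{N}\frac{1}{1-\rho_i}$. $\mathscr{K}_{nb}(G)$ is Kemeny's constant of the non-backtracking random walk on the arcs of $G$ (ordered pairs $(u,v)$ with $\{u,v\}$ an edge), where from $(u,v)$ one moves to $(v,w)$ with probability $1/(\deg(v)-1)$ for each neighbor $w\neq u$ of $v$. *)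

(* Defs.v *)
From mathcomp Require Import all_boot all_order all_algebra all_field.
Set Implicit Arguments. Unset Strict Implicit. Unset Printing Implicit Defensive.
Import Order.TTheory GRing.Theory Num.Theory.
Local Open Scope ring_scope.

(* eigenvalues (with algebraic multiplicity) of a square complex matrix:
   the roots of its characteristic polynomial (monic, so lead_coef = 1). *)
Definition eigenvalues (m : nat) (M : 'M[algC]_m) : seq algC :=
  sval (closed_field_poly_normal (char_poly M)).

Definition kemeny (m : nat) (M : 'M[algC]_m) : algC :=
  \sum_(r <- rem 1 (eigenvalues M)) (1 - r)^-1.

Section NB.
Variables (V : finType) (adj : rel V).

Definition arc := {p : V * V | adj p.1 p.2}.

Definition deg (v : V) : nat := #|[set w | adj v w]|.

Definition nb_prob (e f : arc) : algC :=
  let: (u, v) := val e in let: (x, w) := val f in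
  if (x == v) && (w != u) then ((deg v)%:R - 1)^-1 else 0.

Definition nb_matrix : 'M[algC]_#|{: arc}| :=
  \matrix_(i, j) nb_prob (enum_val i) (enum_val j).

Definition K_nb : algC := kemeny nb_matrix.
End NB.

(* ---------- cycle barbell CB(k,a,b) ----------
   Vertices 0 .. a+b+k-3.  Cycle C_a on 0..a-1, path P_k on a-1..a+k-2,
   cycle C_b on a+k-2 .. a+b+k-3.  Edges: {i,i+1} for all consecutive i,
   plus the closing edges {0,a-1} and {a+k-2, a+b+k-3}. *)
Definition cb_nverts (k a b : nat) : nat := (a + b + k - 2)%N.

Definition cb_adj_nat (k a b : nat) (u v : nat) : bool :=
  let n := cb_nverts k a b in
  [|| u.+1 == v, v.+1 == u,
      [&& u == 0%N & v == a.-1] || [&& v == 0%N & u == a.-1],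
      [&& u == (a + k - 2)%N & v == n.-1] | [&& v == (a + k - 2)%N & u == n.-1]].

Definition cb_adj (k a b : nat) : rel 'I_(cb_nverts k a b) :=
  fun u v => cb_adj_nat k a b u v.

Definition K_nb_CB (k a b : nat) : algC := K_nb (@cb_adj k a b).

(* Main.v *)
(* Every arc of CB(k,a,b) lies on exactly one of six directed segments: either
   cycle or the path, run through in one of its two directions.  Inside a segment
   the walk is deterministic, and it chooses between two segments, with
   probability 1/2 each, only when it leaves one.  So the transition matrix is
   P = S + E W, where S follows the segments and E W has rank at most 6.  As S
   strictly decreases the number of steps left in the segment, det(x - S) = x^N,
   and det(1 - A B) = det(1 - B A) reduces det(x - P) to a 6 x 6 determinant.
   With G = (2 X^a - 1)(2 X^b - 1) this yields
     16 char_poly(P) = G (G X^(2(k-1)) - 1).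
   The root 1 is simple, hence K = p''(1) / (2 p'(1)) for p = char_poly(P), i.e.
     K = 2 s - 1/2 + m - (a^2 + b^2) / (2 m),  s = a + b,  m = s + k - 1 = n + 1.
   For fixed m this is largest when s is maximal and a, b are balanced. *)
Require Import Defs.
From mathcomp Require Import all_boot all_order all_algebra all_field.
From mathcomp Require Import fingroup perm zify ring.
Set Implicit Arguments. Unset Strict Implicit. Unset Printing Implicit Defensive.
Import Order.TTheory GRing.Theory Num.Theory.
Local Open Scope ring_scope.

(** * Determinants, characteristic polynomials and Kemeny's constant *)

(** The block matrix with rows (1, A), (B, 1), multiplied by the unitriangular one with rows (1, 0),
    (-B, 1) on either side, becomes block triangular; the two orders give the two sides. *)
Lemma det_1B_mulC (R : comPzRingType) m n (A : 'M[R]_(m, n)) (B : 'M[R]_(n, m)) :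
  \det (1%:M - A *m B) = \det (1%:M - B *m A).
Proof.
have e1 : block_mx 1%:M A B 1%:M *m block_mx 1%:M 0 (- B) 1%:M
        = block_mx (1%:M - A *m B) A 0 1%:M.
  by rewrite mulmx_block !mulmx1 !mul1mx !mulmx0 mulmxN subrr !add0r.
have e2 : block_mx 1%:M 0 (- B) 1%:M *m block_mx 1%:M A B 1%:M
        = block_mx 1%:M A 0 (1%:M - B *m A).
  by rewrite mulmx_block !mulmx1 !mul1mx !mul0mx !addr0 mulNmx addNr addrC.
have := det_mulmx (block_mx 1%:M A B 1%:M) (block_mx 1%:M 0 (- B) 1%:M).
rewrite mulrC -det_mulmx e1 e2 det_ublock det_ublock !det1 mulr1 mul1r; exact.
Qed.

(* A permutation other than 1 contributes 0 to the determinant: if all its factors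
   were nonzero, it would decrease the sum of the [r i]. *)
Lemma det_scalar_sub_decr (R : comNzRingType) m (x : R) (S : 'M[R]_m) (r : 'I_m -> nat) :
  (forall i j, S i j != 0 -> (r j < r i)%N) -> \det (x%:M - S) = x ^+ m.
Proof.
move=> hS; rewrite /determinant (bigD1 (1%g : 'S_m)) //= odd_perm1 expr0 mul1r.
have hd i : S i i = 0 by apply/eqP/negP => /negP /hS; rewrite ltnn.
rewrite [X in X + _](eq_bigr (fun=> x)) => [|i _]; last first.
  by rewrite perm1 !mxE eqxx mulr1n hd subr0.
rewrite prodr_const card_ord big1 ?addr0 // => s hs.
suff /existsP[i /eqP hi] : [exists i, (x%:M - S) i (s i) == 0].
  by rewrite (bigD1 i) //= hi mul0r mulr0.
apply/contraT; rewrite negb_exists => /forallP hn.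
have hle i : (r (s i) <= r i)%N.
  have := hn i; rewrite !mxE; have [<-|_] // := eqVneq i (s i).
  by rewrite mulr0n sub0r oppr_eq0 => /hS /ltnW.
have [i hi] : exists i, s i != i.
  apply/existsP; rewrite -[X in is_true X]negbK negb_exists.
  apply: contra hs => /forallP h.
  by apply/eqP/permP=> i; rewrite perm1; apply/eqP; rewrite -[_ == _]negbK h.
have hlt : (r (s i) < r i)%N.
  have := hn i; rewrite !mxE [i == _]eq_sym (negbTE hi) mulr0n sub0r oppr_eq0; exact: hS.
have : (\sum_j r j = \sum_j r (s j))%N by rewrite (reindex_inj (@perm_inj _ s)).
rewrite (bigD1 i) //= [RHS](bigD1 i) //= => h.
have : (\sum_(j | j != i) r (s j) <= \sum_(j | j != i) r j)%N.
  by apply: leq_sum => j _.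
by move=> /(leq_add hlt); rewrite addSn h ltnn.
Qed.

Lemma horner_char_poly (R : comNzRingType) m (P : 'M[R]_m) (x : R) :
  (char_poly P).[x] = \det (x%:M - P).
Proof.
rewrite -[LHS]/(horner_eval x _) -det_map_mx; congr (\det _).
apply/matrixP=> i j; rewrite !mxE /= /horner_eval.
by rewrite !(hornerD, hornerN, hornerC, hornerMn, hornerX).
Qed.

(** The difference vanishes at 1, 2, 3, ..., which are distinct and nonzero. This recovers
    [char_poly] from a determinant formula that involves inverse powers of x. *)
Lemma poly_eq_nonzero (R : numDomainType) (p q : {poly R}) :
  (forall x, x != 0 -> p.[x] = q.[x]) -> p = q.
Proof.
move=> h; apply/eqP; rewrite -subr_eq0; apply/eqP.
apply: (@roots_geq_poly_eq0 _ _ [seq i.+1%:R | i <- iota 0 (size (p - q)%R)]).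
- apply/allP=> _ /mapP[i _ ->]; rewrite rootE !hornerE h ?subrr //.
  by rewrite pnatr_eq0.
- rewrite map_inj_uniq ?iota_uniq // => i j /eqP.
  by rewrite eqr_nat => /eqP[].
- by rewrite size_map size_iota.
Qed.

(** Logarithmic derivative of a product of linear factors. *)
Lemma sum_inv_prod (F : fieldType) (s : seq F) (x : F) :
  let q := \prod_(r <- s) ('X - r%:P) in
  q.[x] != 0 -> \sum_(r <- s) (x - r)^-1 = q^`().[x] / q.[x].
Proof.
elim: s => [|r s IHs] /=; first by rewrite !big_nil derivC horner0 mul0r.
rewrite !big_cons derivM derivXsubC mul1r hornerM hornerXsubC mulf_eq0 => /norP[h1 h2].
rewrite IHs // !hornerE; field; by rewrite h1 h2.
Qed.

(** Write p = (X - 1) q, with q carrying the other eigenvalues. Then p'(1) = q(1) and p''(1) = 2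
    q'(1), so the sum is the logarithmic derivative of q at 1. *)
Lemma kemeny_char_poly m (M : 'M[algC]_m) : let p := char_poly M in
  p.[1] = 0 -> p^`().[1] != 0 -> kemeny M = p^`()^`().[1] / (2 * p^`().[1]).
Proof.
move=> p p1 dp; rewrite /kemeny /eigenvalues; case: closed_field_poly_normal => s /=.
rewrite -/p (monicP (char_poly_monic M)) scale1r => ps.
have s1 : 1 \in s by move/eqP: p1; rewrite -/(root p 1) ps root_prod_XsubC.
rewrite (perm_big _ (perm_to_rem s1)) big_cons /= in ps.
set q := \prod_(_ <- _) _ in ps.
have e1 : p^`().[1] = q.[1].
  by rewrite ps derivM derivXsubC mul1r !hornerE subrr mul0r addr0.
have e2 : p^`()^`().[1] = 2 * q^`().[1].
  rewrite ps derivM derivXsubC mul1r derivD derivM derivXsubC mul1r.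
  by rewrite !(hornerXsubC, hornerD, hornerM) subrr mul0r addr0 mulr_natl mulr2n.
rewrite e1 in dp; rewrite e1 e2.
apply: etrans (@sum_inv_prod algC (rem 1 s) 1 dp) _; rewrite -/q.
by field.
Qed.

(** * Laplace expansion on lists and the 6 x 6 determinant *)

Fixpoint delete T (j : nat) (s : seq T) : seq T :=
  if s is x :: s' then if j is j'.+1 then x :: delete j' s' else s' else [::].

Lemma nth_delete T (x0 : T) j s i : nth x0 (delete j s) i = nth x0 s (bump j i).
Proof.
elim: s j i => [|x s IHs] [|j] [|i] //=; rewrite ?nth_nil //.
by rewrite IHs /bump ltnS addnS.
Qed.

Fixpoint laplace (R : nzRingType) (n : nat) (rows : seq (seq R)) : R :=
  if n is n'.+1 then
    \sum_(j <- iota 0 n) nth 0 (head [::] rows) j *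
      ((-1) ^+ j * laplace n' [seq delete j r | r <- behead rows])
  else 1.

Lemma laplaceS (R : nzRingType) n (rows : seq (seq R)) :
  laplace n.+1 rows = \sum_(j <- iota 0 n.+1) nth 0 (head [::] rows) j *
      ((-1) ^+ j * laplace n [seq delete j r | r <- behead rows]).
Proof. by []. Qed.

Lemma det_laplace (R : comNzRingType) n (rows : seq (seq R)) :
  \det (\matrix_(i < n, j < n) nth 0 (nth [::] rows i) j) = laplace n rows.
Proof.
elim: n rows => [|n IHn] rows; first by rewrite det_mx00.
rewrite (expand_det_row _ ord0) laplaceS.
have -> : iota 0 n.+1 = index_iota 0 n.+1 by rewrite /index_iota subn0.
rewrite big_mkord; apply: eq_bigr => j _; rewrite mxE /= nth0 /cofactor -IHn.
congr (_ * (_ * \det _)); apply/matrixP => i l; rewrite !mxE lift0 -nth_behead.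
have [hi|hi] := ltnP i (size (behead rows)).
  by rewrite (nth_map [::]) // nth_delete.
by rewrite !(nth_default [::]) ?size_map // !nth_nil.
Qed.

Arguments laplace : simpl never.

(* The six segments are numbered 0, 1 for the cycle C_a, 2, 3 for the path away
   from and towards C_a, 4, 5 for the cycle C_b; the two segments that may follow
   [t] are [seg1 t] and [seg2 t]. *)
Definition seg1 t := nth 0%N [:: 0; 1; 4; 0; 4; 5]%N t.
Definition seg2 t := nth 0%N [:: 2; 2; 5; 1; 3; 3]%N t.

(** Swapping the two directions of one cycle is a symmetry: the antisymmetric vectors give the first
    two factors. The rest is the determinant on symmetric vectors, whose last term is the tour
    cycle, path, cycle, path: four branchings, and two directions for each cycle. *)
Lemma det_segments (R : comNzRingType) (h p l q : R) :
  let y := nth 0 [:: p; p; l; l; q; q] in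
  \det (\matrix_(i < 6, j < 6) ((i == j)%:R -
     h * ((seg1 i == j)%:R * y j + (seg2 i == j)%:R * y j))) =
  (1 - h * p) * (1 - h * q) * ((1 - h * p) * (1 - h * q) - 4 * h ^+ 4 * p * q * l ^+ 2).
Proof.
move=> y.
pose rows := [:: [:: 1 - h * p; 0; - (h * l); 0; 0; 0];
                 [:: 0; 1 - h * p; - (h * l); 0; 0; 0];
                 [:: 0; 0; 1; 0; - (h * q); - (h * q)];
                 [:: - (h * p); - (h * p); 0; 1; 0; 0];
                 [:: 0; 0; 0; - (h * l); 1 - h * q; 0];
                 [:: 0; 0; 0; - (h * l); 0; 1 - h * q]].
transitivity (\det (\matrix_(i < 6, j < 6) (nth 0 (nth [::] rows i) j))).
  congr (\det _); apply/matrixP=> i j; rewrite !mxE -val_eqE /=.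
  case: i j => [[|[|[|[|[|[|i]]]]]] hi] [[|[|[|[|[|[|j]]]]]] hj] //=;
   rewrite /y /=; ring.
rewrite det_laplace /rows.
(* Zero entries are dropped after each expansion, before their minors get expanded. *)
do 6 (rewrite !laplaceS /= !big_cons !big_nil ?mul0r ?add0r ?addr0).
rewrite /laplace /=.
ring.
Qed.

(** * Arcs and successors in an arbitrary graph *)

Section Arcs.
Variables (V : finType) (adj : rel V).

Lemma sum_arc (R : nmodType) (F : V -> V -> R) :
  \sum_(f : Defs.arc adj) F (val f).1 (val f).2 = \sum_u \sum_(v | adj u v) F u v.
Proof.
rewrite pair_big_dep /= -(big_sub (fun p : V * V => adj p.1 p.2) (fun p => F p.1 p.2)).
by apply: eq_bigl => p; rewrite unfold_in.
Qed.

Lemma card_arc : #|{: Defs.arc adj}| = (\sum_u deg adj u)%N.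
Proof.
rewrite card_sig -sum1_card -(pair_big_dep xpredT adj (fun _ _ => 1%N)) /=.
apply: eq_bigr => u _; rewrite /deg -sum1_card.
by apply: eq_bigl => v; rewrite inE.
Qed.

Lemma sum_successors (u v : V) (z : algC) (F : V -> V -> algC) :
  \sum_(f : Defs.arc adj) 
    (if ((val f).1 == v) && ((val f).2 != u) then z else 0) * F (val f).1 (val f).2
  = z * \sum_(w | adj v w && (w != u)) F v w.
Proof.
rewrite (sum_arc (fun x w => (if (x == v) && (w != u) then z else 0) * F x w)).
rewrite (bigD1 v) //= [X in _ + X]big1 ?addr0 => [|x /negbTE hx]; last first.
  by rewrite big1 // => w _; rewrite hx mul0r.
rewrite big_distrr /= big_mkcondr /=; apply: eq_bigr => w _.
by rewrite eqxx /=; case: ifP; rewrite ?mul0r.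
Qed.

Lemma nb_probE (e f : Defs.arc adj) : nb_prob e f =
  if ((val f).1 == (val e).2) && ((val f).2 != (val e).1)
  then ((deg adj (val e).2)%:R - 1)^-1 else 0.
Proof. by case: e f => [[u v] huv] [[x w] hxw]. Qed.

End Arcs.

Lemma card_ord_mem n (s : seq nat) : uniq s -> all (fun i => i < n)%N s ->
  #|[set w : 'I_n | (w : nat) \in s]| = size s.
Proof.
move=> us /allP hs; rewrite cardE -(size_map (@nat_of_ord n)); apply: perm_size.
apply: uniq_perm => //; first by rewrite (map_inj_uniq val_inj) enum_uniq.
move=> i; apply/mapP/idP => [[w]|hi]; first by rewrite mem_enum inE => hw ->.
by exists (Ordinal (hs i hi)) => //; rewrite mem_enum inE.
Qed.

(** * The directed segments of the barbell *)

Section CycleBarbell.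
Variables k a b : nat.
Hypotheses (a3 : (3 <= a)%N) (b3 : (3 <= b)%N) (k2 : (2 <= k)%N).
Let n := cb_nverts k a b.
Let c := (a + k - 2)%N.
Let adjn := cb_adj_nat k a b.
Let adj := @cb_adj k a b.
Let A := Defs.arc adj.

Local Close Scope ring_scope.

(** Segment 0 leaves [a.-1] by the closing arc to 0 and climbs back to [a.-1]; segment 4 climbs from
    [c] and closes by [n.-1] to [c]; 1 and 5 are their reverses. The tests are ordered, so [v <= c]
    in the third concerns only path arcs. *)
Definition seg (u v : nat) : nat :=
  if [&& u == a.-1 & v == 0] || [&& v == u.+1 & v < a] then 0
  else if [&& v == a.-1 & u == 0] || [&& u == v.+1 & u < a] then 1
  else if [&& v == u.+1 & v <= c] then 2
  else if [&& u == v.+1 & u <= c] then 3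
  else if (v == u.+1) || [&& u == n.-1 & v == c] then 4 else 5.

(* The number of arcs from (u, v), included, to the end of its segment. *)
Definition steps (u v : nat) : nat :=
  nth 0 [:: a - v; u.+1; c.+1 - v; u.+1 - a; n - u; v.+1 - c] (seg u v).

(* The last arc of segment [t] is (last_tail t, last_head t); from there the walk
   moves to [succ1 t] or [succ2 t]. *)
Definition last_tail (t : nat) := nth 0 [:: a - 2; 0; c.-1; a; n.-1; c.+1] t.
Definition last_head (t : nat) := nth 0 [:: a.-1; a.-1; c; a.-1; c; c] t.
Definition succ1 (t : nat) := nth 0 [:: 0; a - 2; c.+1; 0; c.+1; n.-1] t.
Definition succ2 (t : nat) := nth 0 [:: a; a; n.-1; a - 2; c.-1; c.-1] t.

Lemma seg_lt u v : seg u v < 6.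
Proof. by rewrite /seg; do !case: ifP. Qed.

Lemma adj_sym u v : adjn u v -> adjn v u.
Proof. rewrite /adjn /cb_adj_nat; lia. Qed.

(** Indexed by the values of [seg] and [steps], so that a case on [arcP] replaces both and leaves
    linear conditions for [lia]. *)
Variant arc_spec (u v : nat) : nat -> nat -> Prop :=
| ArcA1 of u = a.-1 /\ v = 0 \/ v = u.+1 /\ v < a : arc_spec u v 0 (a - v)
| ArcA2 of v = a.-1 /\ u = 0 \/ u = v.+1 /\ u < a : arc_spec u v 1 u.+1
| ArcL1 of v = u.+1 & a <= v <= c : arc_spec u v 2 (c.+1 - v)
| ArcL2 of u = v.+1 & a <= u <= c : arc_spec u v 3 (u.+1 - a)
| ArcB1 of v = u.+1 /\ c < v \/ u = n.-1 /\ v = c : arc_spec u v 4 (n - u)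
| ArcB2 of u = v.+1 /\ c < u \/ v = n.-1 /\ u = c : arc_spec u v 5 (v.+1 - c).

Lemma adjP u v : adjn u v ->
  [\/ v = u.+1, u = v.+1, u = 0 /\ v = a.-1 \/ v = 0 /\ u = a.-1 |
      u = c /\ v = n.-1 \/ v = c /\ u = n.-1].
Proof.
rewrite /adjn /cb_adj_nat -/n -/c.
case/or4P=> [/eqP->|/eqP->|/orP[]/andP[/eqP-> /eqP->]|].
- by constructor 1.
- by constructor 2.
- by constructor 3; left.
- by constructor 3; right.
by case/orP=> /andP[/eqP-> /eqP->]; constructor 4; [left|right].
Qed.

Lemma arcP u v : adjn u v -> arc_spec u v (seg u v) (steps u v).
Proof.
have hc : a <= c by rewrite /c; lia.
have hn : n.-1 = c + b.-1 by rewrite /c /n /cb_nverts; lia.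
move=> /adjP; rewrite /steps /seg.
case=> [->|->|[[-> ->]|[-> ->]]|[[-> ->]|[-> ->]]]; rewrite ?hn.
all: repeat (case: ifP => /= hh; first
  [by exfalso; move: hc hh; clear -a3 b3; lia | move: hh => ?]).
all: try (apply: ArcA1 => //).
all: try (apply: ArcA2 => //).
all: try (apply: ArcL1 => //).
all: try (apply: ArcL2 => //).
all: try (apply: ArcB1 => //).
all: try (apply: ArcB2 => //).
all: rewrite ?hn; lia.
Qed.

Lemma steps_gt0 u v : u < n -> v < n -> adjn u v -> 0 < steps u v.
Proof.
move=> hu hv /arcP; move: hu hv; rewrite /n /c /cb_nverts => hu hv [];
 rewrite /n /c /cb_nverts; lia.
Qed.

Lemma last_arc u v : u < n -> v < n -> adjn u v -> steps u v = 1 ->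
  u = last_tail (seg u v) /\ v = last_head (seg u v).
Proof.
move=> hu hv /arcP; move: hu hv; rewrite /n /c /cb_nverts => hu hv [];
 rewrite /last_tail /last_head /= /n /c /cb_nverts; lia.
Qed.

(** Before the last arc of its segment the walk is at a vertex of degree 2, where only the next arc
    avoids backtracking. *)
Lemma steps_succ u v w : u < n -> v < n -> w < n -> adjn u v -> adjn v w -> w != u ->
  1 < steps u v -> seg v w = seg u v /\ steps v w = (steps u v).-1.
Proof.
move=> hu hv hw /arcP huv /arcP hvw; move: hu hv hw huv hvw => hu hv hw.
case=> [h1|h1|h1 h1'|h1 h1'|h1|h1] [h2|h2|h2 h2'|h2 h2'|h2|h2];
  move: a3 b3 k2 hu hv hw h1 h2; try move: h1'; try move: h2';
  rewrite /n /c /cb_nverts; clear; lia.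
Qed.

Lemma adj_succ t w : t < 6 -> w < n ->
  adjn (last_head t) w && (w != last_tail t) = (w == succ1 t) || (w == succ2 t).
Proof.
move=> ht hw; apply/idP/idP.
  case/andP=> /adjP h /eqP hne; suff : w = succ1 t \/ w = succ2 t.
    by case=> ->; rewrite eqxx ?orbT.
  move: a3 b3 k2 ht hw hne h; clear.
  rewrite /last_tail /last_head /succ1 /succ2 /n /cb_nverts /c.
  by move: t => [|[|[|[|[|[|t]]]]]] //= ? ? ? _ ? ? []; lia.
move: ht hw; rewrite /adjn /cb_adj_nat.
rewrite /last_tail /last_head /succ1 /succ2 /n /cb_nverts /c.
by case: t => [|[|[|[|[|[|t]]]]]] //= _ _ /orP[]/eqP->; lia.
Qed.

Lemma succ_lt t :
  [/\ succ1 t < n, succ2 t < n, last_head t < n & t < 6 -> succ1 t != succ2 t].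
Proof.
rewrite /last_head /succ1 /succ2 /n /cb_nverts /c.
move: t => [|[|[|[|[|[|t]]]]]] /=; split; rewrite ?nth_nil; lia.
Qed.

Definition seglen t := nth 0 [:: a; a; k.-1; k.-1; b; b] t.

(** Both successors of a last arc are first arcs, hence a full segment away from the end. This turns
    the walk into the table [seg1], [seg2]. *)
Lemma seg_succ t : t < 6 ->
  [/\ seg (last_head t) (succ1 t) = seg1 t,
      seg (last_head t) (succ2 t) = seg2 t,
      steps (last_head t) (succ1 t) = seglen (seg1 t) &
      steps (last_head t) (succ2 t) = seglen (seg2 t)].
Proof.
move=> ht; have [h1 h2 hh _] := succ_lt t.
have : adjn (last_head t) (succ1 t) && (succ1 t != last_tail t).
  by rewrite adj_succ ?eqxx.
have : adjn (last_head t) (succ2 t) && (succ2 t != last_tail t).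
  by rewrite adj_succ ?eqxx ?orbT.
case/andP=> /arcP e2 _ /andP[/arcP e1 _].
have : seg (last_head t) (succ1 t) = seg1 t /\
       steps (last_head t) (succ1 t) = seglen (seg1 t).
  case: e1; move: a3 b3 k2 ht; clear;
  rewrite /last_tail /last_head /succ1 /succ2 /n /cb_nverts /c;
  by move: t => [|[|[|[|[|[|t]]]]]] //=; rewrite /seg1 /seglen /=; lia.
have : seg (last_head t) (succ2 t) = seg2 t /\
       steps (last_head t) (succ2 t) = seglen (seg2 t).
  case: e2; move: a3 b3 k2 ht; clear;
  rewrite /last_tail /last_head /succ1 /succ2 /n /cb_nverts /c;
  by move: t => [|[|[|[|[|[|t]]]]]] //=; rewrite /seg2 /seglen /=; lia.
by move=> [? ?] [? ?].
Qed.

Local Open Scope ring_scope.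

(** * Degrees and the number of arcs *)

Definition nbrs (v : nat) : seq nat :=
  if v == 0%N then [:: 1; a.-1]%N
  else if v == a.-1 then [:: a - 2; 0; a]%N
  else if v == c then [:: c.-1; c.+1; n.-1]%N
  else if v == n.-1 then [:: n.-2; c]%N
  else [:: v.-1; v.+1].

Lemma mem_nbrs v w : (v < n)%N -> (w < n)%N -> cb_adj_nat k a b v w = (w \in nbrs v).
Proof.
move=> hv hw; apply/idP/idP.
  move/adjP; move: hv hw; rewrite /nbrs -/n -/c.
  have hn : n.-1 = (c + b.-1)%N by rewrite /c /n /cb_nverts; lia.
  have hn0 : n = (c + b.-1).+1 by rewrite /c /n /cb_nverts; lia.
  have hc : (a <= c)%N by rewrite /c; lia.
  rewrite hn hn0 /= ; move: a3 b3 hc; clear.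
  generalize c => c0 ? ? ? ? ?.
  by do !case: eqP => ?; rewrite !inE; case; lia.
rewrite /nbrs /cb_adj_nat; move: hv hw; rewrite /n /c /cb_nverts.
move: a3 b3 k2; clear; move=> ? ? ? ? ?.
by case: eqP => ?; [|case: eqP => ?; [|case: eqP => ?; [|case: eqP => ?]]]; rewrite !inE;
  try (case/or3P=> /eqP); try (case/orP=> /eqP) ; lia.
Qed.

Lemma deg_cb (v : 'I_n) : deg adj v = (2 + (v == a.-1 :> nat) + (v == c :> nat))%N.
Proof.
rewrite /deg (_ : [set w | adj v w] = [set w : 'I_n | (w : nat) \in nbrs v]); last first.
  by apply/setP=> w; rewrite !inE -mem_nbrs.
have hv := ltn_ord v; move: hv; rewrite {-4}/n /c /cb_nverts => hv.
rewrite card_ord_mem; rewrite /nbrs /n /c /cb_nverts;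
  do !(case: eqP => ? /=); rewrite ?inE; lia.
Qed.

Lemma card_arc_cb : #|{: Defs.arc adj}| = (2 * (a + b + k.-1))%N.
Proof.
rewrite card_arc (eq_bigr _ (fun v _ => deg_cb v)) !big_split /=.
have sum1 (i : nat) : (i < n)%N -> (\sum_(v < n) (v == i :> nat) = 1)%N.
  move=> hi; rewrite (bigD1 (Ordinal hi)) //= eqxx big1 // => v.
  by rewrite -val_eqE /= => /negbTE->.
rewrite !sum1 ?sum_nat_const ?card_ord; rewrite /n /c /cb_nverts; lia.
Qed.

(** * Reduction of the characteristic determinant to six segments *)

Lemma sum_enum_arc (R : nmodType) (F : A -> R) :
  \sum_(j < #|{: A}|) F (enum_val j) = \sum_f F f.
Proof. by rewrite -(big_enum_val (A := {: A}) F). Qed.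

Lemma card_successors (u v : 'I_n) : adj u v ->
  #|[pred w | adj v w && (w != u)]| = (deg adj v).-1.
Proof.
move=> /adj_sym huv.
rewrite /deg (cardsD1 u) inE [adj v u]huv add1n /=.
by rewrite -cardsE; apply: eq_card => w; rewrite !inE andbC.
Qed.

(** Column t of (x - S)^-1 E in closed form: x - S maps it to the indicator of the last arc of
    segment t. *)
Definition seg_weight (x : algC) (t : nat) (u v : nat) : algC :=
  (seg u v == t)%:R * x ^- steps u v.

(** All successors carry the same weight, so averaging over them returns it. *)
Lemma sum_nb_prob x t (e : A) : (1 < steps (val e).1 (val e).2)%N ->
  \sum_f nb_prob e f * seg_weight x t (val f).1 (val f).2 =
  (seg (val e).1 (val e).2 == t)%:R * x ^- (steps (val e).1 (val e).2).-1.
Proof.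
move=> hs; under eq_bigr => f _ do rewrite nb_probE.
rewrite (sum_successors adj (val e).1 (val e).2 _ (fun u v : 'I_n => seg_weight x t u v)).
have he : adj (val e).1 (val e).2 := valP e.
set u := (val e).1 in hs he *; set v := (val e).2 in hs he *.
rewrite (eq_bigr (fun=> (seg u v == t)%:R * x ^- (steps u v).-1)); last first.
  move=> w /andP[hvw hwu]; rewrite /seg_weight.
  by have [-> ->] := steps_succ (ltn_ord u) (ltn_ord v) (ltn_ord w) he hvw hwu hs.
rewrite sumr_const card_successors // -[X in _ * X]mulr_natl mulrA.
rewrite deg_cb // !addSn add0n /= -natr1 addrK -mulrA mulKf //.
by rewrite pnatr_eq0.
Qed.

(** Row t of W: the law of the step out of the last arc of segment t. *)
Definition last_weight (t u v : nat) : algC :=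
  if (u == last_head t) && (v != last_tail t) then 2^-1 else 0.

Lemma sum_last x (t t' : nat) : (t < 6)%N ->
  \sum_(f : A) last_weight t (val f).1 (val f).2 * seg_weight x t' (val f).1 (val f).2
  = 2^-1 * ((seg1 t == t')%:R * x ^- seglen t' + (seg2 t == t')%:R * x ^- seglen t').
Proof.
move=> ht; have [h1 h2 hh hne] := succ_lt t.
rewrite (sum_arc adj (fun u v : 'I_n => last_weight t u v * seg_weight x t' u v)).
rewrite /last_weight.
rewrite (bigD1 (Ordinal hh)) //= [X in _ + X]big1 ?addr0 => [|u hu]; last first.
  by rewrite big1 // => w _; rewrite -val_eqE /= in hu; rewrite (negbTE hu) mul0r.
rewrite eqxx /=.
under eq_bigr => w _ do rewrite (fun_if (fun z => z * _)) mul0r.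
rewrite -big_mkcondr /=.
rewrite (eq_bigl (fun w : 'I_n => (w == Ordinal h1) || (w == Ordinal h2))); last first.
  by move=> w; rewrite -!val_eqE /= -(adj_succ ht (ltn_ord w)).
rewrite (bigD1 (Ordinal h1)) ?eqxx //= (bigD1 (Ordinal h2)) /=; last first.
  by rewrite eqxx orbT /= -val_eqE /= eq_sym hne.
rewrite big1 ?addr0 => [|w]; last by case: eqP => //= _; case: eqP.
rewrite -mulrDr /seg_weight; have [-> -> -> ->] := seg_succ ht.
by congr (_ * (_ + _)); case: eqP => [->|]; rewrite ?mul0r.
Qed.

(** With Y = (x - S)^-1 E given explicitly by [seg_weight], x - P = (x - S)(1 - Y W), and det(1 - Y
    W) = det(1 - W Y) has size 6. *)
Lemma det_nb_cb (x : algC) : x != 0 ->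
  let y := nth 0 [:: x ^- a; x ^- a; x ^- k.-1; x ^- k.-1; x ^- b; x ^- b] in
  \det (x%:M - nb_matrix adj) = x ^+ #|{: A}| *
   \det (\matrix_(i < 6, j < 6) ((i == j)%:R - 
     2^-1 * ((seg1 i == j)%:R * y j + (seg2 i == j)%:R * y j))).
Proof.
move=> x0 y.
pose ev (i : 'I_#|{: A}|) := val (enum_val i : A).
pose sg i := seg (ev i).1 (ev i).2.
pose st i := steps (ev i).1 (ev i).2.
have adjev i : adj (ev i).1 (ev i).2 by exact: (valP (enum_val i)).
have st0 i : (0 < st i)%N by apply: (steps_gt0 _ _ (adjev i)).
pose S := \matrix_(i, j) if (1 < st i)%N then nb_matrix adj i j else 0.
pose Y := \matrix_(i < #|{: A}|, t < 6) seg_weight x t (ev i).1 (ev i).2.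
pose E : 'M[algC]_(_, 6) :=
  \matrix_(i < #|{: A}|, t < 6) ((sg i == t) && (st i == 1))%:R.
pose W := \matrix_(t < 6, j < #|{: A}|) last_weight t (ev j).1 (ev j).2.
(* [st] is the quantity that strictly decreases along S. *)
have hS : \det (x%:M - S) = x ^+ #|{: A}|.
  apply: (@det_scalar_sub_decr _ _ x S st) => i j; rewrite !mxE.
  case: ifP => [hi|]; last by rewrite eqxx.
  rewrite nb_probE; case: ifP => [/andP[/eqP e1 e2] _|]; last by rewrite eqxx.
  have hij : adj (ev i).2 (ev j).2 by have := adjev j; rewrite /ev e1.
  have [] := steps_succ _ _ _ (adjev i) hij e2 hi; rewrite ?ltn_ord // => _.
  rewrite /st /ev e1 => ->; rewrite -/ev -/(st i).
  by case: (st i) (st0 i).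
have hY : (x%:M - S) *m Y = E.
  apply/matrixP=> i t; rewrite mulmxBl mul_scalar_mx !mxE.
  have [hi|hi] := ltnP 1 (st i).
    under eq_bigr => j _ do rewrite !mxE hi.
    rewrite (sum_enum_arc (fun f => nb_prob (enum_val i) f *
                                    seg_weight x t (val f).1 (val f).2)).
    rewrite sum_nb_prob // /seg_weight -/(ev i) -/(sg i) -/(st i).
    case: (st i) hi => [|[|r]] //= _; rewrite andbF exprS invfM.
    by rewrite mulrCA [x * _]mulrA divff // mul1r subrr.
  have hi1 : st i = 1%N by apply/eqP; rewrite eqn_leq hi st0.
  rewrite big1 => [|j _]; last by rewrite !mxE hi1 mul0r.
  by rewrite subr0 /seg_weight -/(sg i) -/(st i) hi1 andbT mulrCA divff // mulr1.
(* Rows with [st i > 1] come from S, those of last arcs from E W. *)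
have hP : nb_matrix adj = S + E *m W.
  apply/matrixP=> i j; rewrite !mxE.
  have hsg := seg_lt (ev i).1 (ev i).2.
  have [hi|hi] := ltnP 1 (st i).
    by rewrite big1 ?addr0 // => t _; rewrite !mxE (gtn_eqF hi) andbF mul0r.
  have hi1 : st i = 1%N by apply/eqP; rewrite eqn_leq hi st0.
  rewrite add0r (bigD1 (Ordinal hsg)) //= big1 ?addr0 => [|t ht]; last first.
    rewrite !mxE (_ : sg i == t = false) ?mul0r //.
    by apply/negbTE; rewrite eq_sym -val_eqE in ht.
  rewrite !mxE /= eqxx hi1 mul1r nb_probE /last_weight.
  have [e1 e2] := last_arc (ltn_ord _) (ltn_ord _) (adjev i) hi1.
  rewrite -e1 -e2; congr (if _ then _^-1 else _).
  rewrite deg_cb //; rewrite -/(ev i) e2.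
  have := hsg; rewrite -/(sg i) /last_head.
  (* As k >= 2, the vertices [a.-1] and [c] differ, so both have degree exactly 3 and the
     probability is 1/2. *)
  have [hne hne'] : a.-1 == (a + k - 2)%N = false /\
                    (a + k - 2)%N == a.-1 = false by lia.
  by case: (sg i) => [|[|[|[|[|[|t]]]]]] //= _;
    rewrite eqxx ?hne ?hne' -[1]/(1%:R) -natrB.
have -> : x%:M - nb_matrix adj = (x%:M - S) *m (1%:M - Y *m W).
  by rewrite mulmxBr mulmx1 mulmxA hY hP opprD addrA.
rewrite det_mulmx hS det_1B_mulC; congr (_ * \det _).
apply/matrixP=> t t'; rewrite !mxE; congr (_ - _).
under eq_bigr => j _ do rewrite !mxE.
rewrite (sum_enum_arc (fun f => last_weight t (val f).1 (val f).2 *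
                                seg_weight x t' (val f).1 (val f).2)).
rewrite sum_last //; have -> : x ^- seglen t' = y t'; last by [].
by case: t' => [[|[|[|[|[|[|t']]]]]] ht'].
Qed.

End CycleBarbell.

(** * The characteristic polynomial and its derivatives at 1 *)

Definition loop_poly (a b : nat) : {poly algC} :=
  (2%:P * 'X^a - 1) * (2%:P * 'X^b - 1).

Lemma char_poly_cb k a b : (3 <= a)%N -> (3 <= b)%N -> (2 <= k)%N ->
  char_poly (nb_matrix (@cb_adj k a b)) =
  (16^-1)%:P * (loop_poly a b * (loop_poly a b * 'X^(2 * k.-1) - 1)).
Proof.
move=> a3 b3 k2; apply: poly_eq_nonzero => x x0.
rewrite horner_char_poly det_nb_cb // det_segments card_arc_cb //.
rewrite /loop_poly !(hornerM, hornerD, hornerN, hornerC, hornerXn).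
have x2 i : x ^+ (2 * i) = (x ^+ i) ^+ 2 by rewrite mulnC exprM.
rewrite !x2 !exprD.
have := expf_neq0 a x0; have := expf_neq0 b x0; have := expf_neq0 k.-1 x0.
move: (x ^+ a) (x ^+ b) (x ^+ k.-1) => p q r r0 q0 p0.
field; by rewrite p0 q0 r0.
Qed.

Lemma horner1_derivM (R : comNzRingType) (p q : {poly R}) :
  (p * q)^`().[1] = p^`().[1] * q.[1] + p.[1] * q^`().[1].
Proof. by rewrite derivM hornerD !hornerM. Qed.

Lemma horner1_deriv2M (R : comNzRingType) (p q : {poly R}) :
  (p * q)^`()^`().[1] =
  p^`()^`().[1] * q.[1] + 2 * (p^`().[1] * q^`().[1]) + p.[1] * q^`()^`().[1].
Proof. by rewrite derivM derivD !derivM !hornerD !hornerM; ring. Qed.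

Lemma horner1_derivXn (R : comNzRingType) i : ('X^i : {poly R})^`().[1] = i%:R.
Proof. by rewrite derivXn hornerMn hornerXn expr1n. Qed.

Lemma horner1_deriv2Xn (R : comNzRingType) i :
  ('X^i : {poly R})^`()^`().[1] = i%:R * (i%:R - 1).
Proof.
rewrite derivXn derivMn derivXn !hornerMn hornerXn expr1n.
case: i => [|i]; first by rewrite !mulr0n mul0r.
by rewrite -[i.+1%:R - 1]/(i.+1%:R - 1%:R) -natrB // subn1 /= -mulr_natl.
Qed.

(** Stated as a quotient of naturals with denominator 2 m, m = a + b + k - 1, so that barbells of
    equal order are compared by their numerators in [nat]. *)
Lemma K_nb_CBE k a b : (3 <= a)%N -> (3 <= b)%N -> (2 <= k)%N ->
  K_nb_CB k a b =
  (((4 * (a + b) - 1) * (a + b + k.-1)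
     + (a ^ 2 + b ^ 2 + 4 * a * b + 4 * k.-1 * (a + b) + 2 * k.-1 ^ 2))%N)%:R
  / (2 * (a + b + k.-1))%N%:R.
Proof.
move=> a3 b3 k2; have := char_poly_cb a3 b3 k2.
set p := char_poly _; set G := loop_poly a b; set H := _ - 1 => ep.
pose u i : {poly algC} := 2%:P * 'X^i - 1.
have u0 i : (u i).[1] = 1.
  by rewrite /u hornerD hornerN hornerM hornerXn expr1n !hornerC; ring.
have u1 i : (u i)^`().[1] = 2 * i%:R.
  rewrite /u derivB hornerD hornerN horner1_derivM horner1_derivXn.
  by rewrite !derivC !hornerC; ring.
have u2 i : (u i)^`()^`().[1] = 2 * (i%:R * (i%:R - 1)).
  rewrite /u !derivB hornerD hornerN horner1_deriv2M horner1_deriv2Xn.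
  by rewrite !derivC !hornerC; ring.
have G0 : G.[1] = 1 by rewrite hornerM !u0 mulr1.
have G1 : G^`().[1] = 2 * (a%:R + b%:R).
  by rewrite horner1_derivM !u0 !u1; ring.
have G2 : G^`()^`().[1] =
    2 * (a%:R * (a%:R - 1)) + 8 * a%:R * b%:R + 2 * (b%:R * (b%:R - 1)).
  by rewrite horner1_deriv2M !u0 !u1 !u2; ring.
have H0 : H.[1] = 0.
  by rewrite /H hornerD hornerN hornerM hornerXn expr1n G0 hornerC; ring.
have H1 : H^`().[1] = 2 * (a%:R + b%:R + k.-1%:R).
  rewrite /H derivB hornerD hornerN horner1_derivM horner1_derivXn hornerXn.
  by rewrite expr1n G0 G1 derivC hornerC natrM; ring.
have H2 : H^`()^`().[1] =
    G^`()^`().[1] + 8 * (a%:R + b%:R) * k.-1%:R + 2 * k.-1%:R * (2 * k.-1%:R - 1).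
  rewrite /H !derivB hornerD hornerN horner1_deriv2M horner1_deriv2Xn.
  by rewrite horner1_derivXn hornerXn expr1n G0 G1 !derivC hornerC natrM; ring.
have m0 : a%:R + b%:R + k.-1%:R != 0 :> algC.
  by rewrite -!natrD pnatr_eq0; lia.
(* H(1) = 0 and G(1) = 1, so only terms containing a derivative of H survive, and p'(1) = H'(1) / 16
   is nonzero. *)
have p0 : p.[1] = 0 by rewrite ep !hornerM H0 !mulr0.
have p1 : p^`().[1] = 8^-1 * (a%:R + b%:R + k.-1%:R).
  rewrite ep horner1_derivM horner1_derivM derivC !hornerC hornerM H0 H1 G0; by field.
have p2 : p^`()^`().[1] = 16^-1 * (2 * (G^`().[1] * H^`().[1]) + H^`()^`().[1]).
  rewrite ep horner1_deriv2M (horner1_deriv2M G) !derivC !hornerC H0 G0; ring.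
rewrite /K_nb_CB /K_nb kemeny_char_poly -/p // ?p1 ?mulf_neq0 ?invr_eq0 ?pnatr_eq0 //.
rewrite p2 H2 G1 G2 H1 !natrD !natrM natrB ?natrM ?natrD ?natrX; last by lia.
by field; rewrite m0 -mulr2n mulrn_eq0 (negbTE m0).
Qed.

(** * Optimization at a fixed number of vertices *)

(** This is the comparison of the two constants, times 2 m, with m = h + h + o + 1 and d = k - 2.
    For d = 0 balanced squares are smallest; for d > 0 the term 4 d m outweighs the loss in a^2 +
    b^2. *)
Lemma balanced_sum_sqr (a b d h : nat) (o : bool) : (a + b + d = h + h + o)%N ->
  ((h + o) ^ 2 + h ^ 2 <= 4 * d * (h + h + o + 1) + a ^ 2 + b ^ 2)%N.
Proof.
wlog le_ab : a b / (a <= b)%N.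
  move=> H e; case: (leqP a b) => [le|/ltnW le]; first exact: H.
  by have := H b a le; rewrite [(b + a)%N]addnC => /(_ e); rewrite addnAC.
case: d => [|d] e.
  have [e1 [ea eb]] : exists e1, (a + e1 = h /\ b = h + o + e1)%N.
    by exists (h - a)%N; case: o e; lia.
  by rewrite eb -ea; nia.
have [e1 eb] : exists e1, b = (a + e1)%N by exists (b - a)%N; lia.
by case: o e; rewrite eb; nia.
Qed.

Theorem theorem5p7 (n : nat) : (6 <= n)%N ->
  (forall k a b : nat, (3 <= a)%N -> (3 <= b)%N -> (2 <= k)%N ->
     cb_nverts k a b = n ->
     K_nb_CB k a b <= K_nb_CB 2 (uphalf n) n./2) /\
  (~~ odd n -> K_nb_CB 2 n./2 n./2
     = (11 * n%:R ^+ 2 + 14 * n%:R + 2) / (4 * (n%:R + 1))) /\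
  (odd n -> K_nb_CB 2 n.+1./2 n.-1./2
     = (11 * n%:R ^+ 2 + 14 * n%:R + 1) / (4 * (n%:R + 1))).
Proof.
move=> n6.
split; last split.
- move=> k a b a3 b3 k2 hn.
  have [h [hu hh]] : exists h, uphalf n = (h + odd n)%N /\ n./2 = h.
    by exists n./2; split=> //; rewrite uphalf_half addnC.
  have en : n = (h + h + odd n)%N by rewrite -[LHS]odd_double_half hh -addnn addnC.
  rewrite hu hh !K_nb_CBE //; try lia.
  (* Both barbells have m = n + 1, so the denominators agree. *)
  have em : (h + odd n + h + 2.-1 = a + b + k.-1)%N by move: hn; rewrite /cb_nverts; lia.
  rewrite em ler_pM2r; last by rewrite invr_gt0 ltr0n; lia.
  rewrite ler_nat.
  move: (odd n) en em => o en em.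
  have [d ek] : exists d, k.-1 = d.+1 by exists (k - 2)%N; lia.
  rewrite ek in em *.
  have ed : (a + b + d = h + h + o)%N by lia.
  have := balanced_sum_sqr ed.
  (* Removes the truncated subtraction in [4 * s - 1]. *)
  have subm s t : (0 < s)%N -> ((4 * s - 1) * t + t = 4 * s * t)%N by nia.
  have /(subm _ (a + b + d.+1)%N) e1 : (0 < a + b)%N by lia.
  have /(subm _ (a + b + d.+1)%N) e2 : (0 < h + o + h)%N by lia.
  (* The quadratic part of either numerator is 2 m^2 minus the sum of the squared cycle lengths;
     [i3] isolates the gain 4 d m from the longer cycles. *)
  have i1 : ((a ^ 2 + b ^ 2 + 4 * a * b + 4 * d.+1 * (a + b) + 2 * d.+1 ^ 2)
      + (a ^ 2 + b ^ 2) = 2 * (a + b + d.+1) ^ 2)%N by ring.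
  have i2 : ((h + o) ^ 2 + h ^ 2 + 4 * (h + o) * h + 4 * 2.-1 * (h + o + h)
      + 2 * 2.-1 ^ 2 + ((h + o) ^ 2 + h ^ 2) = 2 * (a + b + d.+1) ^ 2)%N.
    by rewrite -em /=; ring.
  have i3 : (4 * (h + o + h) * (a + b + d.+1) =
      4 * (a + b) * (a + b + d.+1) + 4 * d * (h + h + o + 1))%N.
    by rewrite -ed (_ : h + o + h = a + b + d)%N; [ring|lia].
  lia.
- move=> no; have [h en] : exists h, n = h.*2.
    by exists n./2; rewrite -[LHS]odd_double_half (negbTE no).
  rewrite en doubleK in n6 *; rewrite K_nb_CBE //; try lia.
  rewrite /= -addnn !(natrD, natrM, natrX) natrB ?(natrD, natrM); last by lia.
  by field; rewrite -natrD natr1 pnatr_eq0.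
- move=> no; have [h en] : exists h, n = h.*2.+1.
    by exists n./2; rewrite -[LHS]odd_double_half no.
  have -> : n.+1./2 = h.+1 by rewrite en -doubleS doubleK.
  have -> : n.-1./2 = h by rewrite en /= doubleK.
  rewrite K_nb_CBE //; try lia.
  rewrite en /= -addnn !(natrD, natrM, natrX) natrB ?(natrD, natrM); last by lia.
  rewrite -natr1.
  by field; rewrite nat1r -natrD natr1 pnatr_eq0.
Qed.
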